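(* For every squarefree composite positive integer $N$, the set $\mathbb{Q}\text{-}\mathcal{KS}(N)$ is finite; i.e. there are only finitely many $N$-Korselt rational bases.
   Context: For a positive integer $N\ge 2$, the $\mathbb{Q}$-Korselt set $\mathbb{Q}\text{-}\mathcal{KS}(N)$ is the set of all rationals $\alpha=\frac{\alpha_1}{\alpha_2}\in\mathbb{Q}\setminus\{0,N\}$ (written with $\alpha_1\in\mathbb{Z}$, $\alpha_2>0$, $\gcd(\alpha_1,\alpha_2)=1$) such that the integer $\alpha_2p-\alpha_1$ divides the integer $\alpha_2N-\alpha_1$ for every prime divisor $p$ of $N$. Its elements are called $N$-Korselt rational bases. *)

(* Defs.v *)
From mathcomp Require Import all_boot all_order all_algebra.
From mathcomp Require Import classical_sets cardinality.

Set Implicit Arguments.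
Unset Strict Implicit.
Unset Printing Implicit Defensive.

Import GRing.Theory Num.Theory.

Local Open Scope ring_scope.
Local Open Scope classical_set_scope.

Definition squarefree (n : nat) : Prop :=
  forall d : nat, (d ^ 2 %| n)%N -> d = 1%N.

Definition composite (n : nat) : bool := (1 < n)%N && ~~ prime n.

(* If denq alpha * p = numq alpha then the divisor below is 0, and 0 divides
   only 0 in the sense of dvdz. *)
Definition Korselt_base (N : nat) (alpha : rat) : Prop :=
  [/\ alpha != 0, alpha != N%:R &
      forall p : nat, prime p -> (p %| N)%N ->
        (denq alpha * p%:Z - numq alpha %| denq alpha * N%:Z - numq alpha)%Z].

Definition QKS (N : nat) : set rat := [set alpha | Korselt_base N alpha].

(* Main.v *)
Require Import Defs.
From mathcomp Require Import all_boot all_order all_algebra.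
From mathcomp Require Import classical_sets cardinality.
From mathcomp Require Import zify.

(** Write [alpha = a / b] in lowest terms. For a prime [p] dividing [N], the
    integer [b p - a] divides [b N - a], hence also [b (N - p)]; being coprime
    to [b], it divides [N - p], which is nonzero as [N] is composite, so
    [|b p - a| <= N]. Since [N] is squarefree it has two distinct prime
    divisors, and subtracting the two bounds bounds [b], hence also [a]. *)

Import GRing.Theory Num.Theory.
Local Open Scope ring_scope.
Local Open Scope classical_set_scope.

Lemma finite_rat_bounded (A : set rat) (M : nat) :
  (forall x, A x -> (`|numq x| <= M)%N /\ (`|denq x| <= M)%N) -> finite_set A.
Proof.
move=> bndA.
pose r := [seq Posz n | n <- iota 0 M.+1].
(* Numerators take both signs, while denominators are positive, so [r] suffices for [j]; the entries
   with [j = 0] evaluate to 0 and do no harm. *)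
pose s := [seq i%:~R / j%:~R : rat | i <- r ++ [seq - n | n <- r], j <- r].
apply: (@sub_finite_set _ _ [set` s]); last exact: finite_seq.
have in_r (n : nat) : (n <= M)%N -> Posz n \in r.
  by move=> le_nM; rewrite mem_map ?mem_iota //; move=> ? ? [].
move=> x /bndA [num_le den_le] /=.
rewrite -[x]divq_num_den.
apply: (allpairs_f (fun i j : int => i%:~R / j%:~R : rat)).
- rewrite mem_cat; case: (numq x) num_le => n n_le; first by rewrite in_r.
  by rewrite NegzE orbC map_f ?in_r.
- by rewrite -(gtz0_abs (denq_gt0 x)) in_r.
Qed.

(** Take the least prime factor [p] of [N] and the least prime factor [q] of the cofactor
    [m = N / p], where [m > 1] as [N] is not prime; [p = q] would make [p ^ 2] divide [N]. *)
Lemma two_prime_divisors (N : nat) : squarefree N -> composite N ->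
  exists p q : nat, [/\ prime p, prime q, (p %| N)%N, (q %| N)%N & (p < q)%N].
Proof.
move=> sqfN /andP[N_gt1 NprN].
have pr_p := pdiv_prime N_gt1; set p := pdiv N in pr_p *.
have /dvdnP[m defN] : (p %| N)%N := pdiv_dvd N.
have m_gt1 : (1 < m)%N.
  case: m defN => [|[|m]] // defN; first by rewrite defN in N_gt1.
  by move: NprN; rewrite defN mul1n pr_p.
have pr_q := pdiv_prime m_gt1; set q := pdiv m in pr_q *.
have q_dvd : (q %| m)%N := pdiv_dvd m.
have q_dvdN : (q %| N)%N by rewrite defN dvdn_mulr.
have p_dvdN : (p %| N)%N by rewrite defN dvdn_mull.
have [lt_pq|lt_qp|eq_pq] := ltngtP p q; first by exists p, q.
- by exists q, p.
- have p1 : p = 1%N by apply: sqfN; rewrite -mulnn defN dvdn_mul // eq_pq.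
  by rewrite p1 in pr_p.
Qed.

Lemma Korselt_base_bound (N p : nat) (x : rat) :
    composite N -> Korselt_base N x -> prime p -> (p %| N)%N ->
  (`|(denq x * p%:Z - numq x)%R| <= N)%N.
Proof.
move=> /andP[N_gt1 NprN] [_ _ KN] pr_p p_dvdN.
have lt_pN : (p < N)%N.
  rewrite ltn_neqAle dvdn_leq ?andbT //; last exact: ltnW.
  by apply: contraNneq NprN => <-.
have dvd_dN : (denq x * p%:Z - numq x %| denq x * (N%:Z - p%:Z))%Z.
  have -> : denq x * (N%:Z - p%:Z) =
      (denq x * N%:Z - numq x) - (denq x * p%:Z - numq x).
    by rewrite mulrBr opprB addrA subrK.
  by rewrite rpredB ?KN // dvdzz.
have cop : coprimez (denq x * p%:Z - numq x) (denq x).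
  (* Modulo [denq x] the divisor reduces to [- numq x]. *)
  rewrite coprimez_sym /coprimez (mulrC (denq x)) gcdzMDl.
  rewrite -/(coprimez _ _) coprimez_sym coprimezE abszN.
  exact: coprime_num_den.
have : (denq x * p%:Z - numq x %| N%:Z - p%:Z)%Z.
  by rewrite -(Gauss_dvdzr _ cop).
rewrite dvdzE => /dvdn_leq; lia.
Qed.

Theorem theorem2p2 (N : nat) (Nsqf : squarefree N) (Ncomp : composite N) :
  finite_set (QKS N).
Proof.
have [p [q [pr_p pr_q p_dvdN q_dvdN lt_pq]]] := two_prime_divisors N Nsqf Ncomp.
(* With [b <= 2N], [|a| <= |b p - a| + b p <= N + 2 N p]; the last summand [2 * N] covers [b]
   itself. *)
apply: (@finite_rat_bounded _ (N + 2 * N * p + 2 * N)%N) => x Kx.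
have := Korselt_base_bound N p x Ncomp Kx pr_p p_dvdN.
have := Korselt_base_bound N q x Ncomp Kx pr_q q_dvdN.
have := denq_gt0 x; move: (denq x) (numq x) => b a b_gt0 le_q le_p.
(* As [q - p >= 1], [b <= b (q - p) = (b q - a) - (b p - a) <= 2N]. *)
have b_le : b <= 2 * N%:Z by nia.
by split; nia.
Qed.
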